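(* Let $H$ be a real Hilbert space, $\widehat{H}=H\cup\{\infty\}$, and let $U\subset V\subset\widehat{H}$ be non-empty proper subsets, with associated Apollonian (pseudo-)metrics $d_U$ and $d_V$. Let $$\Delta=\sup_{u_1,u_2\in U} d_V(u_1,u_2)\in[0,+\infty].$$ Then for every $x_1,x_2\in U$: $$d_V(x_1,x_2)\le\Big(\tanh\frac{\Delta}{4}\Big)\,d_U(x_1,x_2).$$ In particular, if $\Delta<+\infty$, the embedding $i:(U,d_U)\hookrightarrow(V,d_V)$ is a uniform contraction, i.e. Lipschitz with a constant strictly less than $1$.
   Context: $H$ is a real Hilbert space of arbitrary (finite or infinite) dimension with norm $\|\cdot\|$, and $\widehat{H}=H\cup\{\infty\}$ is its one-point completion. For $x_1,x_2,u_1,u_2\in\widehat{H}$ with $\{x_1,x_2\}\cap\{u_1,u_2\}=\emptyset$, the cross-ratio is $$[x_1,x_2;u_1,u_2]=\frac{\|x_2-u_1\|\,\|x_1-u_2\|}{\|x_1-u_1\|\,\|x_2-u_2\|},$$ with the usual conventions at $\infty$: factors involving $\infty$ cancel between numerator and denominator. Equivalently, one may replace each $\|a-b\|$ by $\widehat{d}(a,b)$, where $\widehat{d}(x,y)=\|x-y\|/(\sqrt{1+\|x\|^2}\sqrt{1+\|y\|^2})$, $\widehat{d}(\infty,y)=\widehat{d}(y,\infty)=1/\sqrt{1+\|y\|^2}$ for $x,y\in H$. A subset $U\subset\widehat{H}$ is called proper if both $U$ and its complement $U^c=\widehat{H}\setminus U$ are non-empty. For such $U$ and $x_1,x_2\in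 U$, the Apollonian (pseudo-)distance is $$d_U(x_1,x_2)=\sup_{u_1,u_2\in U^c}\log[x_1,x_2;u_1,u_2]\in[0,+\infty].$$ It may take the value $+\infty$ and need not separate points. Conventions: $\tanh(+\infty)=1$ and $0\cdot(+\infty)=0$. *)

(* Defs.v *)
From HB Require Import structures.
From mathcomp Require Import all_boot all_order all_algebra.
From mathcomp Require Import all_classical all_reals all_analysis.
From mathcomp Require Import ring.

Set Implicit Arguments.
Unset Strict Implicit.
Unset Printing Implicit Defensive.

Import Order.TTheory GRing.Theory Num.Theory.
Import numFieldNormedType.Exports.

Local Open Scope classical_set_scope.
Local Open Scope ring_scope.

(* [option H] is the one-point completion of H: [None] is the point at infinity
   and [Some x] the point x of H. *)

Section CrossRatio.
Context {R : realType} {H : normedModType R}.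
Implicit Types (x u a b : option H).

(* In a cross-ratio with {x1, x2} and {u1, u2} disjoint, each occurrence of
   infinity contributes one factor above and one below; these cancel, so every
   factor involving infinity is counted as 1. *)
Definition cr_factor a b : R :=
  match a, b with
  | Some p, Some q => `|p - q|
  | _, _ => 1
  end.

Definition cross_ratio x1 x2 u1 u2 : R :=
  (cr_factor x2 u1 * cr_factor x1 u2) / (cr_factor x1 u1 * cr_factor x2 u2).

Definition chordal_dist a b : R :=
  match a, b with
  | Some p, Some q =>
      `|p - q| / (Num.sqrt (1 + `|p| ^+ 2) * Num.sqrt (1 + `|q| ^+ 2))
  | Some p, None | None, Some p => (Num.sqrt (1 + `|p| ^+ 2))^-1
  | None, None => 0
  end.

Let weight a : R := if a is Some p then Num.sqrt (1 + `|p| ^+ 2) else 1.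

Let weight_neq0 a : weight a != 0.
Proof.
case: a => [p|] /=; last exact: oner_neq0.
by rewrite gt_eqF// sqrtr_gt0 ltr_pwDl// sqr_ge0.
Qed.

Let cr_factorE a b : a <> b ->
  cr_factor a b = chordal_dist a b * (weight a * weight b).
Proof.
have w0 p : Num.sqrt (1 + `|p : H| ^+ 2) != 0 by exact: (weight_neq0 (Some p)).
case: a b => [p|] [q|] //= _.
- by rewrite divfK// mulf_neq0.
- by rewrite mulr1 mulVf.
- by rewrite mul1r mulVf.
Qed.

Let chordal_dist_neq0 a b : a <> b -> chordal_dist a b != 0.
Proof.
move=> ab; have: cr_factor a b != 0.
  case: a b ab => [p|] [q|] /= ab; rewrite ?oner_neq0//.
  by rewrite normr_eq0 subr_eq0; apply/eqP => pq; apply: ab; rewrite pq.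
by rewrite cr_factorE// mulf_eq0 negb_or => /andP[].
Qed.

Lemma cross_ratio_chordal x1 x2 u1 u2 :
  x1 <> u1 -> x1 <> u2 -> x2 <> u1 -> x2 <> u2 ->
  cross_ratio x1 x2 u1 u2 =
  (chordal_dist x2 u1 * chordal_dist x1 u2) /
  (chordal_dist x1 u1 * chordal_dist x2 u2).
Proof.
move=> n11 n12 n21 n22; rewrite /cross_ratio !cr_factorE//.
by field; rewrite !chordal_dist_neq0 ?weight_neq0.
Qed.

End CrossRatio.

Definition proper_subset {T : Type} (U : set T) : Prop :=
  U !=set0 /\ ~` U !=set0.

Definition apollonian_dist {R : realType} {H : normedModType R}
    (U : set (option H)) (x1 x2 : option H) : \bar R :=
  ereal_sup [set (ln (cross_ratio x1 x2 u1 u2))%:E | u1 in ~` U & u2 in ~` U].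

Definition diameter {R : realType} {T : Type}
    (d : T -> T -> \bar R) (U : set T) : \bar R :=
  ereal_sup [set d u1 u2 | u1 in U & u2 in U].

Definition tanh {R : realType} (x : R) : R :=
  (expR x - expR (- x)) / (expR x + expR (- x)).

Definition etanh {R : realType} (x : \bar R) : R :=
  match x with
  | r%:E => tanh r
  | +oo%E => 1
  | -oo%E => -1
  end.

Definition uniform_contraction {R : realType} {S T : Type} (D : set S)
    (dS : S -> S -> \bar R) (dT : T -> T -> \bar R) (f : S -> T) : Prop :=
  exists k : R, [/\ 0 <= k, k < 1 & forall x1 x2, D x1 -> D x2 ->
    (dT (f x1) (f x2) <= k%:E * dS x1 x2)%E].

(* Main.v *)
Require Import Defs.
From mathcomp Require Import all_boot all_order all_algebra.
From mathcomp Require Import all_classical all_reals all_analysis.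
From mathcomp Require Import ring lra.
Import Order.TTheory GRing.Theory Num.Theory.
Import numFieldNormedType.Exports.
Local Open Scope classical_set_scope.
Local Open Scope ring_scope.

(** Since d_V(x1, x2) is a supremum over pairs v1, v2 of points outside V, it is
    enough to bound log [x1, x2; v1, v2] by tanh(Delta / 4) d_U(x1, x2) for one
    such pair. When Delta is infinite or zero this is monotonicity of the
    Apollonian distance in the domain, respectively the definition of Delta, so
    let 0 < Delta < +oo.

    Inversions preserve cross-ratios ([cross_ratio_inversion]); an inversion
    centred at v1 therefore reduces the bound to v1 = oo and v2 = c in H. Then
    log [y1, y2; oo, c] = log (|y1 - c| / |y2 - c|), and this is at most Delta
    for y1, y2 in U: the set U lies in an annulus s < |y - c| < t around c whose
    ratio t / s is as close to e^Delta as desired.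

    In that annulus the problem is one-dimensional. Put r_i = |x_i - c|. The
    point u1 at distance t from c on the ray through x1 and the point u2 at
    distance s from c on the ray through x2 are outside U; the numerator of
    [x1, x2; u1, u2] is bounded below by the triangle inequality and its
    denominator is computed exactly, so d_U(x1, x2) is at least the Hilbert
    distance between r1 and r2 in ]s, t[ ([le_apollonian_dist_annulus]).
    Birkhoff's inequality for intervals ([birkhoff_interval]) compares that
    Hilbert distance with log (r1 / r2), with the factor
    tanh(log(t / s) / 4). Letting t / s decrease to e^Delta ends the proof, by
    continuity of tanh. *)

Set Implicit Arguments.
Unset Strict Implicit.

(** * The hyperbolic tangent *)

Section Tanh.
Context {R : realType}.
Implicit Types x y : R.

Lemma expRDN_gt0 x : 0 < expR x + expR (- x).
Proof. by rewrite addr_gt0 ?expR_gt0. Qed.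

Lemma tanh0 : tanh 0 = 0 :> R.
Proof. by rewrite /tanh oppr0 subrr mul0r. Qed.

Lemma tanh_ge0 x : 0 <= x -> 0 <= tanh x.
Proof.
move=> x0; apply: divr_ge0; last exact/ltW/expRDN_gt0.
by rewrite subr_ge0 ler_expR; lra.
Qed.

Lemma tanh_gt0 x : 0 < x -> 0 < tanh x.
Proof.
move=> x0; apply: divr_gt0; last exact/expRDN_gt0.
by rewrite subr_gt0 ltr_expR; lra.
Qed.

Lemma tanh_lt1 x : tanh x < 1.
Proof.
rewrite /tanh ltr_pdivrMr ?expRDN_gt0// mul1r.
by have := expR_gt0 (- x); lra.
Qed.

Lemma continuous_tanh : continuous (@tanh R).
Proof.
move=> x.
have expRN_cvg : expR (- y) @[y --> x] --> expR (- x).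
  by apply: continuous_comp; [exact: opp_continuous|exact: continuous_expR].
apply: cvgM.
  by apply: cvgB; [exact: continuous_expR|exact: expRN_cvg].
apply: cvgV; first by rewrite gt_eqF ?expRDN_gt0.
by apply: cvgD; [exact: continuous_expR|exact: expRN_cvg].
Qed.

End Tanh.

(** * Birkhoff's inequality on an interval *)

Section Birkhoff.
Context {R : realType}.

(** Birkhoff's contraction bound for the Hilbert metric of an interval: on
    ]s, t[ with t / s = e^(4x), the function
    r |-> tanh x * ln ((r - s) / (t - r)) - ln r is nondecreasing. Its derivative
    compares (r - s)(t - r) / r = t + s - r - st / r, whose maximum
    (sqrt t - sqrt s)^2 is reached at the geometric mean w of s and t, and
    the ratio (sqrt t - sqrt s)^2 / (t - s) is exactly tanh x. Parametrising the
    interval by w and x keeps square roots out of the computation. *)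
Lemma birkhoff_interval (w x r1 r2 : R) : 0 < w ->
  let s := w * expR (- x) ^+ 2 in let t := w * expR x ^+ 2 in
  s < r2 -> r2 <= r1 -> r1 < t ->
  ln (r1 / r2) <=
    tanh x * ln (((t - r2) * (r1 - s)) / ((t - r1) * (r2 - s))).
Proof.
move=> w0 s t sr2 r21 r1t.
have EF : expR x * expR (- x) = 1 by rewrite expRxMexpNx_1.
have st : s * t = w ^+ 2.
  transitivity (w ^+ 2 * (expR x * expR (- x)) ^+ 2); first by rewrite /s /t; ring.
  by rewrite EF expr1n mulr1.
have tanh_ts : tanh x * (t - s) = t + s - 2 * w.
  transitivity (w * (expR x - expR (- x)) ^+ 2).
    by rewrite /tanh /s /t; field; rewrite gt_eqF ?expRDN_gt0.
  transitivity (t + s - 2 * w * (expR x * expR (- x))); last by rewrite EF mulr1.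
  by rewrite /s /t; ring.
have s0 : 0 < s by rewrite mulr_gt0// exprn_gt0// expR_gt0.
pose h (r : R) : R := tanh x * (ln (r - s) - ln (t - r)) - ln r.
have dh r : r \in `]s, t[%R ->
    is_derive r 1 h (tanh x * ((r - s)^-1 + (t - r)^-1) - r^-1).
  rewrite in_itv/= => /andP[sr rt].
  have H1 : is_derive r 1 (fun r : R => ln (r - s)) (r - s)^-1.
    have H : is_derive (r - s) 1 (@ln R) (r - s)^-1 by apply: is_derive1_ln; lra.
    have := @is_derive1_comp _ (@ln R) (fun r => r - s) r _ 1 H _.
    rewrite mulr1; apply; rewrite -[X in is_derive _ _ _ X]subr0; exact: is_deriveB.
  have H2 : is_derive r 1 (fun r : R => ln (t - r)) (- (t - r)^-1).
    have H : is_derive (t - r) 1 (@ln R) (t - r)^-1 by apply: is_derive1_ln; lra.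
    have := @is_derive1_comp _ (@ln R) (fun r => t - r) r _ (-1) H _.
    rewrite mulrN1; apply; rewrite -[X in is_derive _ _ _ X]sub0r; exact: is_deriveB.
  have H3 : is_derive r 1 (@ln R) r^-1 by apply: is_derive1_ln; lra.
  have := is_deriveB (is_deriveZ (tanh x) (is_deriveB H1 H2)) H3.
  by rewrite opprK.
have h21 : h r2 <= h r1.
  have der r : r \in `]s, t[%R -> derivable h r 1 by move=> /dh [].
  have cont : {in `]s, t[%classic, continuous h}.
    move=> r; rewrite inE => /der d.
    exact/differentiable_continuous/derivable1_diffP.
  have ge0 r : r \in `]s, t[%R -> 0 <= derive1 h r.
    move=> rst; rewrite derive1E; have [_ ->] := dh r rst.
    move: rst; rewrite in_itv/= => /andP[sr rt].
    (* The numerator (r - w)^2 is the defect in the bound at the maximum w. *)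
    have -> : tanh x * ((r - s)^-1 + (t - r)^-1) - r^-1
      = (r - w) ^+ 2 / ((r - s) * (t - r) * r).
      transitivity (tanh x * (t - s) / ((r - s) * (t - r)) - r^-1).
        by field; rewrite !gt_eqF; lra.
      have -> : (r - w) ^+ 2 = (t + s - 2 * w) * r - (r - s) * (t - r).
        by transitivity (r ^+ 2 - 2 * w * r + s * t); [rewrite st|]; ring.
      by rewrite tanh_ts; field; rewrite !gt_eqF; lra.
    by rewrite divr_ge0 ?sqr_ge0// !mulr_ge0//; lra.
  by apply: (ger0_derive1_le_oo der ge0 cont) => //; rewrite in_itv/=; lra.
have p1 : ln (r1 / r2) = ln r1 - ln r2 by rewrite ln_div// posrE; lra.
rewrite p1 ln_div ?posrE ?mulr_gt0//; try lra.
rewrite !lnM ?posrE; try lra.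
move: h21; rewrite /h.
by set A := ln _; set B := ln _; set C := ln _; set D := ln _; lra.
Qed.

End Birkhoff.

(** * Inversions and cross-ratios *)

Section Inversion.
Context {R : realType} {H : normedModType R}.
Variables (dot : {dot H for idfun}).
Hypothesis dot_norm : forall x : H, dot x x = `|x| ^+ 2.
Implicit Types (x y p : H) (a b : option H).

(** The only place where the norm has to come from an inner product: after
    squaring, both sides are |x|^-2 + |y|^-2 - 2 <x, y> / (|x| |y|)^2. *)
Lemma norm_inversionB x y : x != 0 -> y != 0 ->
  `| `|x| ^- 2 *: x - `|y| ^- 2 *: y| = `|x - y| / (`|x| * `|y|).
Proof.
move=> x0 y0.
have nx : `|x| != 0 by rewrite normr_eq0.
have ny : `|y| != 0 by rewrite normr_eq0.
apply/eqP; rewrite -(@eqrXn2 _ 2%N)//.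
have dotB (u v : H) : dot (u - v) (u - v) = dot u u + dot v v - 2 * dot u v.
  have dotC : dot v u = dot u v by have := hermC dot v u; rewrite expr0 mul1r.
  have -> : dot (u - v) (u - v) = dot u u - dot u v - (dot v u - dot v v).
    by rewrite linearBl !linearBr.
  by rewrite dotC; ring.
have dotZ (a b : R) (u v : H) : dot (a *: u) (b *: v) = a * b * dot u v.
  by rewrite linearZl_LR linearZr_LR /= mulrA.
apply/eqP; rewrite expr_div_n -!dot_norm !dotB !dotZ !dot_norm.
by field; rewrite nx ny.
Qed.

Definition inversion p a : option H :=
  if a is Some x then
    if x == p then None else Some (p + `|x - p| ^- 2 *: (x - p))
  else Some p.

(** Conformal factor of the inversion, so that the norm of a difference is
    multiplied by the product of the factors at its two ends. The value 1 at p
    and at infinity is the one that makes this true as well for the pairs in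
    which infinity occurs, before or after inversion, as these count 1 in
    [cr_factor]. *)
Definition inversion_weight p a : R :=
  if a is Some x then if x == p then 1 else `|x - p|^-1 else 1.

Lemma inversion_weight_neq0 p a : inversion_weight p a != 0.
Proof.
case: a => [x|] /=; last exact: oner_neq0.
have [_|xp] := eqVneq x p; first exact: oner_neq0.
by rewrite invr_neq0// normr_eq0 subr_eq0.
Qed.

Lemma inversionK p : involutive (inversion p).
Proof.
move=> [x|] /=; last by rewrite eqxx.
have [->//|xp] := eqVneq x p.
have d0 : x - p != 0 by rewrite subr_eq0.
have n0 : `|x - p| != 0 by rewrite normr_eq0.
rewrite /inversion -subr_eq0 addrC addKr.
rewrite scaler_eq0 invr_eq0 expf_eq0/= (negbTE n0) (negbTE d0)/=.
rewrite normrZ ger0_norm ?invr_ge0 ?exprn_ge0//.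
rewrite scalerA; congr Some.
set n := `|x - p|.
have -> : (n ^- 2 * n) ^- 2 / n ^+ 2 = 1 by field; rewrite n0.
by rewrite scale1r addrC subrK.
Qed.

Lemma cr_factor_inversion p a b : a <> b ->
  cr_factor (inversion p a) (inversion p b) =
  cr_factor a b * (inversion_weight p a * inversion_weight p b).
Proof.
have n0 x : x != p -> `|x - p| != 0 by rewrite normr_eq0 subr_eq0.
case: a b => [x|] [y|] //= ab.
- have [xp|xp] := eqVneq x p; have [yp|yp] := eqVneq y p.
  + by case: ab; rewrite xp yp.
  + by rewrite /= xp distrC mul1r mulfV ?n0.
  + by rewrite /= yp mulr1 mulfV ?n0.
  + rewrite /= opprD addrACA subrr add0r norm_inversionB ?subr_eq0//.
    by rewrite opprB addrA subrK invfM.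
- have [xp|xp] := eqVneq x p; first by rewrite /= !mulr1.
  rewrite /= addrC addKr normrZ ger0_norm ?invr_ge0 ?exprn_ge0//.
  by rewrite mul1r mulr1; field; exact: n0.
- have [yp|yp] := eqVneq y p; first by rewrite /= !mulr1.
  rewrite /= opprD addrA subrr sub0r normrN.
  rewrite normrZ ger0_norm ?invr_ge0 ?exprn_ge0//.
  by rewrite !mul1r; field; exact: n0.
Qed.

Lemma cr_factor_neq0 a b : a <> b -> cr_factor a b != 0.
Proof.
case: a b => [x|] [y|] //= ab; rewrite ?oner_neq0//.
by rewrite normr_eq0 subr_eq0; apply/eqP => xy; apply: ab; rewrite xy.
Qed.

(** Each of the four points occurs once above and once below the fraction bar,
    so its conformal factor cancels. *)
Lemma cross_ratio_inversion p (x1 x2 u1 u2 : option H) :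
  x1 <> u1 -> x1 <> u2 -> x2 <> u1 -> x2 <> u2 ->
  cross_ratio (inversion p x1) (inversion p x2) (inversion p u1) (inversion p u2)
  = cross_ratio x1 x2 u1 u2.
Proof.
move=> n11 n12 n21 n22; rewrite /cross_ratio !cr_factor_inversion//.
by field; rewrite !cr_factor_neq0 ?inversion_weight_neq0.
Qed.

Lemma apollonian_dist_inversion p (U : set (option H)) (x1 x2 : option H) :
  U x1 -> U x2 ->
  apollonian_dist (inversion p @^-1` U) (inversion p x1) (inversion p x2) =
  apollonian_dist U x1 x2.
Proof.
move=> Ux1 Ux2.
have disj (x u : option H) : U x -> ~ U u -> x <> u.
  by move=> + + xu; rewrite xu.
congr ereal_sup; apply/seteqP; split => _ [u1 Uu1] [u2 Uu2] <-.
- exists (inversion p u1) => //; exists (inversion p u2) => //.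
  by rewrite -(@cross_ratio_inversion p) ?inversionK//; exact: disj.
- exists (inversion p u1); first by rewrite /preimage/= inversionK.
  exists (inversion p u2); first by rewrite /preimage/= inversionK.
  by rewrite cross_ratio_inversion//; exact: disj.
Qed.
End Inversion.

(** * The Apollonian distance of an annulus *)

Section Apollonian.
Context {R : realType} {H : normedModType R}.
Implicit Types (U V : set (option H)).

Lemma ln_cross_ratio_le U (x1 x2 u1 u2 : option H) : ~ U u1 -> ~ U u2 ->
  ((ln (cross_ratio x1 x2 u1 u2))%:E <= apollonian_dist U x1 x2)%E.
Proof. by move=> n1 n2; apply: ereal_sup_ubound; exists u1 => //; exists u2. Qed.

Lemma ln_cross_ratio_diag (x1 x2 u : option H) :
  ln (cross_ratio x1 x2 u u) = 0.
Proof.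
rewrite /cross_ratio [X in _ / X]mulrC.
have [->|n0] := eqVneq (cr_factor x2 u * cr_factor x1 u) 0.
  by rewrite mul0r ln0.
by rewrite mulfV// ln1.
Qed.

Lemma apollonian_dist_ge0 U (x1 x2 : option H) : ~` U !=set0 ->
  (0 <= apollonian_dist U x1 x2)%E.
Proof.
move=> [u nUu]; apply: le_trans (ln_cross_ratio_le x1 x2 nUu nUu).
by rewrite ln_cross_ratio_diag.
Qed.

Lemma apollonian_dist_subset U V (x1 x2 : option H) : U `<=` V ->
  (apollonian_dist V x1 x2 <= apollonian_dist U x1 x2)%E.
Proof.
move=> UV; apply: ereal_sup_le => _ [u1 Vu1] [u2 Vu2] <-.
by exists u1; [move/UV|exists u2 => // /UV].
Qed.

(** On the line through c and x, with c as origin and x on the positive side,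
    u has abscissa t and x has abscissa |x - c|. *)
Lemma dist_radial (c x : H) (t : R) : x != c ->
  let u := c + (t / `|x - c|) *: (x - c) in
  `|u - c| = `|t| /\ `|x - u| = `| `|x - c| - t |.
Proof.
move=> xc u; have n0 : `|x - c| != 0 by rewrite normr_eq0 subr_eq0.
split.
  by rewrite /u addrAC subrr add0r normrZ normf_div normr_id divfK.
have -> : x - u = (1 - t / `|x - c|) *: (x - c).
  by rewrite scalerBl scale1r /u opprD addrA.
rewrite normrZ -[X in _ * X]normr_id -normrM mulrBl mul1r divfK//.
Qed.

(** The bound is the Hilbert distance in ]s, t[ of the two radii. Placing u1
    radially behind x1 on the outer sphere and u2 radially below x2 on the inner
    sphere makes the denominator of the cross-ratio exact, whereas the triangle
    inequality bounds its numerator from below, whatever the angle between x1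
    and x2. *)
Lemma le_apollonian_dist_annulus U (c x1 x2 : H) (s t : R) : 0 < s ->
  (forall a, U a -> exists2 y, a = Some y & s < `|y - c| < t) ->
  U (Some x1) -> U (Some x2) ->
  ((ln (((t - `|x2 - c|) * (`|x1 - c| - s)) /
        ((t - `|x1 - c|) * (`|x2 - c| - s))))%:E
    <= apollonian_dist U (Some x1) (Some x2))%E.
Proof.
move=> s0 Uann Ux1 Ux2.
have [_ [<-] /andP[sr1 r1t]] := Uann _ Ux1.
have [_ [<-] /andP[sr2 r2t]] := Uann _ Ux2.
have xc x : s < `|x - c| -> x != c.
  by move=> sx; rewrite -subr_eq0 -normr_eq0 gt_eqF//; lra.
have [u1c xu1] := dist_radial t (xc _ sr1).
have [u2c xu2] := dist_radial s (xc _ sr2).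
set u1 := c + _ in u1c xu1; set u2 := c + _ in u2c xu2.
have nU1 : ~ U (Some u1).
  by move=> /Uann[_ [<-]]; rewrite u1c ger0_norm; lra.
have nU2 : ~ U (Some u2).
  by move=> /Uann[_ [<-]]; rewrite u2c ger0_norm; lra.
apply: le_trans (ln_cross_ratio_le (Some x1) (Some x2) nU1 nU2).
rewrite lee_fin /cross_ratio /=.
have d21 : t - `|x2 - c| <= `|x2 - u1|.
  have := ler_normB (x2 - c) (x2 - u1).
  rewrite opprB addrC addrA subrK u1c ger0_norm; lra.
have d12 : `|x1 - c| - s <= `|x1 - u2|.
  have := ler_normD (x1 - u2) (u2 - c); rewrite addrA subrK u2c ger0_norm; lra.
rewrite xu1 xu2 [`|_ - t|]ler0_norm ?ger0_norm; try lra.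
rewrite opprB; set A := t - _ in d21 *; set B := _ - s in d12 *.
have A0 : 0 < A by rewrite /A; lra.
have B0 : 0 < B by rewrite /B; lra.
have CD : 0 < (t - `|x1 - c|) * (`|x2 - c| - s) by rewrite mulr_gt0; lra.
rewrite ler_ln ?posrE ?divr_gt0 ?mulr_gt0//; try lra.
by rewrite ler_pM2r ?invr_gt0// ler_pM//; exact: ltW.
Qed.

(** The bound for v1 = oo and v2 = c, the hypothesis on the ratios being what
    remains of the diameter of U. With b the supremum of the distances from U to
    c, these may fill the closed interval from b e^-D to b, hence the slightly
    larger annuli of ratio e^D' with D' > D, and the passage to the limit. *)
Lemma ln_ratio_le_tanh_apollonian U (c x1 x2 : H) (D : R) : 0 < D ->
  ~ U None -> ~ U (Some c) ->
  (forall y1 y2, U (Some y1) -> U (Some y2) ->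
     ln (`|y1 - c| / `|y2 - c|) <= D) ->
  U (Some x1) -> U (Some x2) ->
  ((ln (`|x1 - c| / `|x2 - c|))%:E
    <= (tanh (D / 4))%:E * apollonian_dist U (Some x1) (Some x2))%E.
Proof.
move=> D0 Uoo Uc UD Ux1 Ux2.
have r_gt0 y : U (Some y) -> 0 < `|y - c|.
  move=> Uy; rewrite normr_gt0 subr_eq0; apply/eqP => yc; apply: Uc.
  by rewrite -yc.
have r1 := r_gt0 _ Ux1; have r2 := r_gt0 _ Ux2.
have dU0 : (0 <= apollonian_dist U (Some x1) (Some x2))%E.
  by apply: apollonian_dist_ge0; exists None.
have D4 : 0 < D / 4 by lra.
have [r12|r21] := leP (`|x1 - c|) (`|x2 - c|).
  apply: (@le_trans _ _ 0%E); last by rewrite mule_ge0// lee_fin tanh_ge0// ltW.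
  by rewrite lee_fin ln_le0// ler_pdivrMr// mul1r.
have bnd y1 y2 : U (Some y1) -> U (Some y2) -> `|y1 - c| <= expR D * `|y2 - c|.
  move=> U1 U2; have p1 := r_gt0 _ U1; have p2 := r_gt0 _ U2.
  rewrite -ler_pdivrMr// -ler_ln ?posrE ?expR_gt0 ?divr_gt0//.
  by rewrite expRK; exact: UD.
pose S := [set `|y - c| | y in [set y | U (Some y)]].
have Sub : has_ubound S.
  by exists (expR D * `|x1 - c|) => _ [y Uy <-]; exact: bnd.
have Sne : S !=set0 by exists `|x1 - c|; exists x1.
pose b := sup S.
have le_b y : U (Some y) -> `|y - c| <= b.
  by move=> Uy; apply: ub_le_sup => //; exists y.
have b_le y : U (Some y) -> b <= expR D * `|y - c|.
  by move=> Uy; apply: ge_sup => // _ [z Uz <-]; exact: bnd.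
have b0 : 0 < b by apply: lt_le_trans r1 (le_b _ Ux1).
have approx D' : D < D' -> ((ln (`|x1 - c| / `|x2 - c|))%:E
    <= (tanh (D' / 4))%:E * apollonian_dist U (Some x1) (Some x2))%E.
  move=> DD'.
  (* The geometric mean that puts the outer radius at t = b e^((D' - D) / 2). *)
  pose x := D' / 4; pose w := b * expR ((D' - D) / 2) * expR (- x) ^+ 2.
  have w0 : 0 < w by rewrite !mulr_gt0// ?exprn_gt0 ?expR_gt0.
  have := @birkhoff_interval R w x `|x1 - c| `|x2 - c| w0.
  rewrite /=; set s := w * expR (- x) ^+ 2; set t := w * expR x ^+ 2.
  have tE : t = b * expR ((D' - D) / 2).
    rewrite /t /w -mulrA -exprMn [expR (- x) * _]mulrC expRxMexpNx_1.
    by rewrite expr1n mulr1.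
  have sE : s = b * expR (- D) * expR (- ((D' - D) / 2)).
    rewrite /s /w -!mulrA; congr (_ * _); rewrite !expr2 -!expRD.
    by congr expR; rewrite /x; lra.
  have s0 : 0 < s by rewrite mulr_gt0// exprn_gt0// expR_gt0.
  have ann y : U (Some y) -> s < `|y - c| < t.
    move=> Uy; apply/andP; split.
      apply: (@lt_le_trans _ _ (b * expR (- D))).
        rewrite sE gtr_pMr ?mulr_gt0 ?expR_gt0// expR_lt1; lra.
      by rewrite expRN ler_pdivrMr ?expR_gt0// mulrC b_le.
    apply: le_lt_trans (le_b _ Uy) _.
    by rewrite tE ltr_pMr// expR_gt1; lra.
  have /andP[s2 _] := ann _ Ux2; have /andP[_ t1] := ann _ Ux1.
  move=> /(_ s2 (ltW r21) t1) birk.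
  move: birk; rewrite -lee_fin EFinM => /le_trans; apply.
  apply: lee_wpmul2l; first by rewrite lee_fin tanh_ge0// /x; lra.
  apply: le_apollonian_dist_annulus => // -[y|//] Uy.
  by exists y => //; exact: ann.
case: (apollonian_dist U (Some x1) (Some x2)) dU0 approx => [M| |] //.
- move=> _ approx; rewrite -EFinM lee_fin.
  have tanhD : tanh (D' / 4) * M @[D' --> D^'+] --> tanh (D / 4) * M.
    apply: cvgM; last exact: cvg_cst.
    apply: (@cvg_at_right_filter _ _ (fun D' : R => tanh (D' / 4))).
    apply: (@continuous_comp _ _ _ (fun D' : R => D' / 4) (@tanh R)).
      exact: mulrr_continuous.
    exact: continuous_tanh.
  apply: (cvgr_to_ge tanhD).
  near=> D'; rewrite -lee_fin EFinM; apply: approx.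
  by near: D'; exact: nbhs_right_gt.
- by move=> _ _; rewrite gt0_muley ?leey// lte_fin tanh_gt0.
Unshelve. all: by end_near. Qed.

(** * Reduction to annuli *)

Lemma ln_cross_ratio_le_tanh_infty (U V : set (option H))
    (x1 x2 v : option H) (D : R) : 0 < D -> U `<=` V -> ~ V None -> ~ V v ->
  (forall a b, U a -> U b -> (apollonian_dist V a b <= D%:E)%E) ->
  U x1 -> U x2 ->
  ((ln (cross_ratio x1 x2 None v))%:E
    <= (tanh (D / 4))%:E * apollonian_dist U x1 x2)%E.
Proof.
move=> D0 UV Voo Vv UD Ux1 Ux2.
have Uoo : ~ U None by move/UV.
(* If v is infinity as well, the cross-ratio is 1. *)
case: v Vv => [c|] Vv; last first.
  rewrite ln_cross_ratio_diag mule_ge0//; first by rewrite lee_fin tanh_ge0//; lra.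
  by apply: apollonian_dist_ge0; exists None.
have crE (y1 y2 : H) : cross_ratio (Some y1) (Some y2) None (Some c)
    = `|y1 - c| / `|y2 - c| by rewrite /cross_ratio /= !mul1r.
case: x1 x2 Ux1 Ux2 => [x1|//] [x2|//] Ux1 Ux2; rewrite crE.
apply: ln_ratio_le_tanh_apollonian => //; first by move/UV.
move=> y1 y2 Uy1 Uy2; rewrite -lee_fin -crE.
exact: le_trans (ln_cross_ratio_le _ _ Voo Vv) (UD _ _ Uy1 Uy2).
Qed.

(** An inversion centred at v1 brings the general pair to the case v1 = oo; all
    Apollonian distances involved are unchanged. *)
Lemma ln_cross_ratio_le_tanh (dot : {dot H for idfun})
    (dot_norm : forall x : H, dot x x = `|x| ^+ 2)
    (U V : set (option H)) (x1 x2 v1 v2 : option H) (D : R) :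
  0 < D -> U `<=` V -> ~ V v1 -> ~ V v2 ->
  (forall a b, U a -> U b -> (apollonian_dist V a b <= D%:E)%E) ->
  U x1 -> U x2 ->
  ((ln (cross_ratio x1 x2 v1 v2))%:E
    <= (tanh (D / 4))%:E * apollonian_dist U x1 x2)%E.
Proof.
case: v1 => [p|]; last exact: ln_cross_ratio_le_tanh_infty.
move=> D0 UV Vp Vv UD Ux1 Ux2.
have disj a v : U a -> ~ V v -> a <> v by move=> /UV + + av; rewrite av.
rewrite -(cross_ratio_inversion dot_norm p); try exact: disj.
rewrite -(apollonian_dist_inversion dot_norm p)//.
have -> : inversion p (Some p) = None by rewrite /= eqxx.
apply: (@ln_cross_ratio_le_tanh_infty _ (inversion p @^-1` V)) => //.
- by move=> a /UV.
- by rewrite /preimage/= inversionK.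
- move=> a b Ua Ub; rewrite -(inversionK p a) -(inversionK p b).
  by rewrite (apollonian_dist_inversion dot_norm p) ?UD//; exact: UV.
- by rewrite /preimage/= inversionK.
- by rewrite /preimage/= inversionK.
Qed.

End Apollonian.

Unset Implicit Arguments.
Set Strict Implicit.

(* H is a real Hilbert space: a complete normed space whose norm comes from the
   inner product [dot] (a positive definite symmetric bilinear form). *)
Theorem theorem1p2 (R : realType) (H : completeNormedModType R)
    (dot : {dot H for idfun}) (dot_norm : forall x : H, dot x x = `|x| ^+ 2)
    (U V : set (option H)) (properU : proper_subset U)
    (properV : proper_subset V) (subUV : U `<=` V) :
  let Delta := diameter (apollonian_dist V) U in
  (forall x1 x2 : option H, U x1 -> U x2 ->
    (apollonian_dist V x1 x2 <=
      (etanh (Delta * (4^-1)%:E))%:E * apollonian_dist U x1 x2)%E) /\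
  ((Delta < +oo)%E ->
    uniform_contraction U (apollonian_dist U) (apollonian_dist V) id).
Proof.
move=> Delta.
have le_Delta a b : U a -> U b -> (apollonian_dist V a b <= Delta)%E.
  by move=> Ua Ub; apply: ereal_sup_ubound; exists a => //; exists b.
have Delta0 : (0 <= Delta)%E.
  case: properU properV => [[a Ua] _] [_ neV].
  exact: le_trans (apollonian_dist_ge0 a a neV) (le_Delta _ _ Ua Ua).
have main x1 x2 : U x1 -> U x2 -> (apollonian_dist V x1 x2 <=
    (etanh (Delta * (4^-1)%:E))%:E * apollonian_dist U x1 x2)%E.
  move=> Ux1 Ux2; case: Delta Delta0 le_Delta => [D| |] // D0 le_D; last first.
    rewrite gt0_mulye ?lte_fin ?invr_gt0//= mul1e.
    exact: apollonian_dist_subset.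
  rewrite -EFinM /=; move: D0; rewrite lee_fin le_eqVlt => /predU1P[D0|D0].
    by rewrite -D0 mul0r tanh0 mul0e -[0%E]/(0%:E) D0 le_D.
  apply: ge_ereal_sup => _ [v1 Vv1] [v2 Vv2] <-.
  exact: (ln_cross_ratio_le_tanh dot_norm D0 subUV Vv1 Vv2 le_D).
split=> // Doo.
exists (etanh (Delta * (4^-1)%:E)); split.
- case: Delta {le_Delta main} Delta0 Doo => [D| |] //; rewrite lee_fin => D0 _.
  by rewrite -EFinM /= tanh_ge0// divr_ge0.
- case: Delta {le_Delta main} Delta0 Doo => [D| |] //; rewrite lee_fin => D0 _.
  by rewrite -EFinM /= tanh_lt1.
- exact: main.
Qed.
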